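(* (1) Weak rectangular layouts are vertex monotone and edge monotone. (2) Strong rectangular layouts are vertex monotone but not edge monotone. (3) Rectangular duals are neither vertex monotone nor edge monotone.
   Context: For a graph $G=(V,E)$: a weak rectangular layout is a set of axis-parallel rectangles with pairwise disjoint interiors in bijection with $V$ such that for every edge the two rectangles' boundaries share a segment of positive length; a strong rectangular layout additionally requires that this happens only for adjacent vertices. A rectangular dual is a partition of an axis-parallel rectangle into axis-parallel rectangles (no four meeting at a point) in bijection with $V$ such that two rectangles share a boundary segment of positive length iff the vertices are adjacent. All renderings are on the integer grid (integer corners), and the area is that of the smallest enclosing bounding box; for a rendering strategy (weak layouts, strong layouts, or rectangular duals), $A^*(G)$ denotes the minimum area of a rendering of $G$. For $V'\subset V$, $G_{V'}$ is the subgraph induced on $V\setminus V'$; for $E'\subset E$, $G_{E'}$ is the graph with edge set $E\setminus E'$ with isolated vertices removed. A subset $V'$ (resp. $E'$) is rendering preserving if $G_{V'}$ (resp. $G_{E'}$) admits a rendering. A strategy is vertex (resp. edge) monotone if for every graph $G$ admitting a rendering and every rendering-preserving vertex subset $V'$ (resp. edge subset $E'$), $A^*(G_{V'})\le A^*(G)$ (resp. $A^*(G_{E'})\le A^*(G)$). *)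

(* Defs.v *)
From HB Require Import structures.
From mathcomp Require Import all_boot all_order all_algebra.
From mathcomp Require Import boolp classical_sets reals.

Set Implicit Arguments.
Unset Strict Implicit.
Unset Printing Implicit Defensive.

Import Order.TTheory GRing.Theory Num.Theory.
Local Open Scope ring_scope.
Local Open Scope classical_set_scope.

Record sgraph := SGraph {
  vertex :> finType;
  adj : rel vertex;
  adj_sym : symmetric adj;
  adj_irrefl : irreflexive adj
}.

Definition edges (G : sgraph) : {set {set G}} :=
  [set [set p.1; p.2]%SET | p : G * G & adj p.1 p.2]%SET.

Section Subgraphs.
Variable G : sgraph.

Definition del_vertices_adj (V' : {set G}) : rel {v : G | v \notin V'} :=
  fun u v => adj (val u) (val v).

Lemma del_vertices_sym V' : symmetric (@del_vertices_adj V').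
Proof. by move=> u v; apply: adj_sym. Qed.

Lemma del_vertices_irrefl V' : irreflexive (@del_vertices_adj V').
Proof. by move=> u; apply: adj_irrefl. Qed.

Definition del_vertices (V' : {set G}) : sgraph :=
  SGraph (@del_vertices_sym V') (@del_vertices_irrefl V').

Definition kept (E' : {set {set G}}) : rel G :=
  fun u v => adj u v && ([set u; v]%SET \notin E').

Definition del_edges_adj (E' : {set {set G}}) :
    rel {v : G | [exists u, kept E' v u]} :=
  fun u v => kept E' (val u) (val v).

Lemma del_edges_sym E' : symmetric (@del_edges_adj E').
Proof. by move=> u v; rewrite /del_edges_adj /kept adj_sym finset.setUC. Qed.

Lemma del_edges_irrefl E' : irreflexive (@del_edges_adj E').
Proof. by move=> u; rewrite /del_edges_adj /kept adj_irrefl. Qed.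

(* All vertices left isolated are removed, including those that were already
   isolated in G. *)
Definition del_edges (E' : {set {set G}}) : sgraph :=
  SGraph (@del_edges_sym E') (@del_edges_irrefl E').

End Subgraphs.

Record rect := Rect {
  xlo : int; xhi : int; ylo : int; yhi : int;
  xlo_lt_xhi : xlo < xhi;
  ylo_lt_yhi : ylo < yhi
}.

Section Plane.
Variable R : realType.

Definition region (r : rect) : set (R * R) :=
  [set p | (xlo r)%:~R <= p.1 <= (xhi r)%:~R /\
           (ylo r)%:~R <= p.2 <= (yhi r)%:~R].

Definition inside (r : rect) : set (R * R) :=
  [set p | (xlo r)%:~R < p.1 < (xhi r)%:~R /\
           (ylo r)%:~R < p.2 < (yhi r)%:~R].

Definition boundary (r : rect) : set (R * R) := region r `\` inside r.

Definition segment (p q : R * R) : set (R * R) :=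
  [set ((1 - t) * p.1 + t * q.1, (1 - t) * p.2 + t * q.2)
     | t in [set t : R | 0 <= t <= 1]].

Definition share_segment (r s : rect) : Prop :=
  exists p q : R * R, p <> q /\ segment p q `<=` boundary r `&` boundary s.

(* A strategy tells which assignments of grid rectangles to the vertices of a
   graph are its renderings.  Distinct vertices get rectangles with disjoint
   interiors, hence distinct rectangles. *)
Definition strategy := forall G : sgraph, (G -> rect) -> Prop.

Definition interior_disjoint (G : sgraph) (L : G -> rect) : Prop :=
  forall u v, u != v -> inside (L u) `&` inside (L v) = set0.

Definition weak_layout : strategy := fun G L =>
  interior_disjoint L /\
  forall u v, adj u v -> share_segment (L u) (L v).

Definition strong_layout : strategy := fun G L =>
  weak_layout L /\
  forall u v, u != v -> share_segment (L u) (L v) -> adj u v.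

Definition rectangular_dual : strategy := fun G L =>
  [/\ interior_disjoint L,
      exists B : rect, \bigcup_(v in [set: G]) region (L v) = region B,
      forall A : {set G}, #|A| = 4%N ->
        ~ exists p, forall v, v \in A -> region (L v) p
    & forall u v, u != v -> (share_segment (L u) (L v) <-> adj u v)].

End Plane.

(* Area of the bounding box of L, and 0 for the graph without vertices.  In
   each big operator the vertex v0 only provides a starting value that belongs
   to the family. *)
Definition area (G : sgraph) (L : G -> rect) : nat :=
  if [pick v0 : G] is Some v0 then
    (`|(\big[Num.max/xhi (L v0)]_(v : G) xhi (L v)) -
       (\big[Num.min/xlo (L v0)]_(v : G) xlo (L v))| *
     `|(\big[Num.max/yhi (L v0)]_(v : G) yhi (L v)) -
       (\big[Num.min/ylo (L v0)]_(v : G) ylo (L v))|)%N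
  else 0%N.

Section Strategy.
Variable S : strategy.

Definition admits (G : sgraph) : Prop := exists L : G -> rect, S L.

(* Arbitrary value 0 if G has no rendering. *)
Definition min_area (G : sgraph) : nat :=
  xget 0%N [set a | (exists2 L : G -> rect, S L & area L = a) /\
                    forall L : G -> rect, S L -> (a <= area L)%N].

Lemma min_areaP (G : sgraph) : admits G ->
  (exists2 L : G -> rect, S L & area L = min_area G) /\
  forall L : G -> rect, S L -> (min_area G <= area L)%N.
Proof.
case=> L0 SL0; rewrite /min_area; case: xgetP => [a _ //|none].
pose P a := `[< exists2 L : G -> rect, S L & area L = a >].
have exP : exists a, P a by exists (area L0); apply/asboolP; exists L0.
case: (ex_minnP exP) => a /asboolP Pa mina; case: (none a); split=> // L SL.
by apply: mina; apply/asboolP; exists L.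
Qed.

Definition vertex_monotone : Prop :=
  forall (G : sgraph) (V' : {set G}),
    admits G -> admits (del_vertices V') ->
    (min_area (del_vertices V') <= min_area G)%N.

Definition edge_monotone : Prop :=
  forall (G : sgraph) (E' : {set {set G}}), E' \subset edges G ->
    admits G -> admits (del_edges E') ->
    (min_area (del_edges E') <= min_area G)%N.

End Strategy.

(* Main.v *)
(** Restricting a weak (strong) layout to a subgraph (induced subgraph) gives a
layout in the same bounding box, which yields the three positive claims.  The
negative ones are witnessed by
- strong layouts, edges: the path P4 fits in area 4, but deleting its middle
  edge leaves two disjoint edges, which need a gap and hence area 5;
- rectangular duals, edges: two triangles sharing a vertex fit in a 2 x 3 box;
  deleting an edge at the shared vertex leaves a triangle with a tail of length
  2, whose minimum area is 8;
- rectangular duals, vertices: the graph [es] of [dual_not_vertex_monotone] tiles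
  a 3 x 4 box; deleting one vertex leaves a fan over a path of 3 vertices whose hub
  carries a tail of length 3; its cut vertices, the hub among them, have to be
  strips across the whole box, so a 3 x 5 box is needed.
Disjointness of interiors and contact of grid rectangles are integer conditions,
so each lower bound is a finite search over the boxes of bounded area. *)

Require Import Defs.
From mathcomp Require Import all_boot all_order all_algebra.
From mathcomp Require Import boolp classical_sets reals.
From mathcomp Require Import zify lra.

Set Implicit Arguments.
Unset Strict Implicit.
Unset Printing Implicit Defensive.

Import Order.TTheory GRing.Theory Num.Theory.

(** * Contacts between grid rectangles *)

Section RectContact.
Local Open Scope ring_scope.
Local Open Scope classical_set_scope.
Variable R : realType.

Definition xapart (r s : rect) := (xhi r <= xlo s) || (xhi s <= xlo r).
Definition yapart (r s : rect) := (yhi r <= ylo s) || (yhi s <= ylo r).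
Definition xmeet (r s : rect) := (xhi r == xlo s) || (xhi s == xlo r).
Definition ymeet (r s : rect) := (yhi r == ylo s) || (yhi s == ylo r).

(** Meant for rectangles with disjoint interiors: only opposite sides are compared, so overlapping
    rectangles with aligned left sides are not in contact here although they share a segment. *)
Definition rcontact (r s : rect) :=
  xmeet r s && ~~ yapart r s || ymeet r s && ~~ xapart r s.

Lemma itv_apart_point (a b c d : int) (p q : R) :
    (b <= c) || (d <= a) ->
    a%:~R <= p <= b%:~R -> c%:~R <= p <= d%:~R ->
    a%:~R <= q <= b%:~R -> c%:~R <= q <= d%:~R ->
  p = q /\ (b == c) || (d == a).
Proof.
move=> ap /andP[ap1 pb] /andP[cp pd] /andP[aq qb] /andP[cq qd].
case/orP: ap => le.
- have le' := le; rewrite -(ler_int R) in le'.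
  have : c <= b by rewrite -(ler_int R); lra.
  by split; [lra | lia].
- have le' := le; rewrite -(ler_int R) in le'.
  have : a <= d by rewrite -(ler_int R); lra.
  by split; [lra | lia].
Qed.

Lemma itv_overlap (a b c d : int) : a < b -> c < d ->
    ~~ ((b <= c) || (d <= a)) ->
  exists m M : int, [/\ m < M, a <= m, c <= m, M <= b & M <= d].
Proof.
move=> ab cd ov; exists (Num.max a c), (Num.min b d).
by split; lia.
Qed.

(** When both projections overlap, the centre of the common rectangle is interior to both. *)
Lemma disjoint_insideP (r s : rect) :
  @inside R r `&` @inside R s = set0 <-> xapart r s || yapart r s.
Proof.
split=> [disj | ap].
- apply/negPn/negP; rewrite negb_or => /andP[xov yov].
  have [m [M [mM rm sm Mr Ms]]] :=
    itv_overlap (xlo_lt_xhi r) (xlo_lt_xhi s) xov.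
  have [n [N [nN rn sn Nr Ns]]] :=
    itv_overlap (ylo_lt_yhi r) (ylo_lt_yhi s) yov.
  suff : (@inside R r `&` @inside R s)
      ((m%:~R + M%:~R) / 2, (n%:~R + N%:~R) / 2) by rewrite disj.
  move: mM rm sm Mr Ms nN rn sn Nr Ns.
  rewrite -!(ler_int R) -!(ltr_int R) => *.
  by rewrite /inside; do !split=> /=; apply/andP; split; lra.
- rewrite -subset0.
  move=> [p q] [[/= /andP[rp pr] /andP[rq qr]] [/= /andP[sp ps] /andP[sq qs]]].
  case/orP: ap => /orP[]; rewrite -(ler_int R) => le; lra.
Qed.

Lemma segment_vert (x y1 y2 : R) (p : R * R) : y1 <= y2 ->
  segment (x, y1) (x, y2) p -> p.1 = x /\ y1 <= p.2 <= y2.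
Proof. by move=> le [t /= /andP[t0 t1] <-] /=; split; [lra | nra]. Qed.

Lemma segment_horiz (y x1 x2 : R) (p : R * R) : x1 <= x2 ->
  segment (x1, y) (x2, y) p -> p.2 = y /\ x1 <= p.1 <= x2.
Proof. by move=> le [t /= /andP[t0 t1] <-] /=; split; [lra | nra]. Qed.

Lemma boundary_vert (r : rect) (x m M : int) (p : R * R) :
    (x == xlo r) || (x == xhi r) -> ylo r <= m -> M <= yhi r ->
  p.1 = x%:~R -> m%:~R <= p.2 <= M%:~R -> boundary r p.
Proof.
move=> xE; have := xlo_lt_xhi r; rewrite -!(ltr_int R) -!(ler_int R).
case: p => p q /= lt rm Mr -> /andP[mq qM]; split; first by
  split=> /=; [case/orP: xE => /eqP -> | ]; apply/andP; split; lra.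
by case=> /= /andP[]; case/orP: xE => /eqP ->; rewrite ltxx.
Qed.

Lemma boundary_horiz (r : rect) (y m M : int) (p : R * R) :
    (y == ylo r) || (y == yhi r) -> xlo r <= m -> M <= xhi r ->
  p.2 = y%:~R -> m%:~R <= p.1 <= M%:~R -> boundary r p.
Proof.
move=> yE; have := ylo_lt_yhi r; rewrite -!(ltr_int R) -!(ler_int R).
case: p => p q /= lt rm Mr -> /andP[mq qM]; split; first by
  split=> /=; [ | case/orP: yE => /eqP ->]; apply/andP; split; lra.
by case=> /= _ /andP[]; case/orP: yE => /eqP ->; rewrite ltxx.
Qed.

(** The ends of a shared segment lie in both rectangles and agree in each coordinate that separates
    these. Being distinct, they leave a single separating coordinate, in which the sides meet.
    Conversely, the overlap in the other coordinate provides the segment. *)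
Lemma share_segmentP (r s : rect) : xapart r s || yapart r s ->
  share_segment R r s <-> rcontact r s.
Proof.
move=> ap; split.
- move=> [[p1 p2] [[q1 q2] [pq sub]]].
  have /sub[[[/= rp1 rp2] _] [[/= sp1 sp2] _]] :
    segment (p1, p2) (q1, q2) (p1, p2) by exists 0 => /=; [lra | congr pair; lra].
  have /sub[[[/= rq1 rq2] _] [[/= sq1 sq2] _]] :
    segment (p1, p2) (q1, q2) (q1, q2) by exists 1 => /=; [lra | congr pair; lra].
  have xP : xapart r s -> p1 = q1 /\ xmeet r s.
    by move=> xap; apply: (itv_apart_point xap rp1 sp1 rq1 sq1).
  have yP : yapart r s -> p2 = q2 /\ ymeet r s.
    by move=> yap; apply: (itv_apart_point yap rp2 sp2 rq2 sq2).
  rewrite /rcontact.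
  case: (boolP (xapart r s)) ap xP => [xap _ | _ /= yap _].
    move=> /(_ isT)[e1 ->].
    case: (boolP (yapart r s)) yP => [yap /(_ isT)[e2 _] | //].
    by case: pq; rewrite e1 e2.
  by have [_ ->] := yP yap; rewrite orbT.
- case/orP => /andP[meet ov].
  + have [m [M [mM rm sm Mr Ms]]] :=
      itv_overlap (ylo_lt_yhi r) (ylo_lt_yhi s) ov.
    have [x rx sx] : exists2 x, (x == xlo r) || (x == xhi r) &
        (x == xlo s) || (x == xhi s).
      by case/orP: meet => /eqP e; [exists (xhi r) | exists (xlo r)];
        rewrite ?e eqxx ?orbT.
    have mM' : m%:~R < M%:~R :> R by rewrite ltr_int.
    exists (x%:~R, m%:~R), (x%:~R, M%:~R); split; first by case; lra.
    move=> p /(segment_vert (ltW mM'))[px py].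
    by split; [apply: (boundary_vert rx rm Mr) | apply: (boundary_vert sx sm Ms)].
  + have [m [M [mM rm sm Mr Ms]]] :=
      itv_overlap (xlo_lt_xhi r) (xlo_lt_xhi s) ov.
    have [y ry sy] : exists2 y, (y == ylo r) || (y == yhi r) &
        (y == ylo s) || (y == yhi s).
      by case/orP: meet => /eqP e; [exists (yhi r) | exists (ylo r)];
        rewrite ?e eqxx ?orbT.
    have mM' : m%:~R < M%:~R :> R by rewrite ltr_int.
    exists (m%:~R, y%:~R), (M%:~R, y%:~R); split; first by case; lra.
    move=> p /(segment_horiz (ltW mM'))[py px].
    by split; [apply: (boundary_horiz ry rm Mr) | apply: (boundary_horiz sy sm Ms)].
Qed.

End RectContact.

(** * Bounding boxes and monotonicity *)

Section BoundingBox.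
Local Open Scope ring_scope.

Record in_box (x0 y0 : int) (W H : nat) (r : rect) : Prop := InBox {
  in_box_xlo : x0 <= xlo r;
  in_box_xhi : xhi r <= x0 + W%:Z;
  in_box_ylo : y0 <= ylo r;
  in_box_yhi : yhi r <= y0 + H%:Z
}.

Lemma bigmax_attained (I : finType) (F : I -> int) (i0 : I) :
  exists i, \big[Num.max/F i0]_i F i = F i.
Proof.
apply: (big_ind (fun x => exists i, x = F i)); [by exists i0| |by move=> i; exists i].
by move=> _ _ [i ->] [j ->]; case: (leP (F i) (F j)) => _; [exists j | exists i].
Qed.

Lemma bigmin_attained (I : finType) (F : I -> int) (i0 : I) :
  exists i, \big[Num.min/F i0]_i F i = F i.
Proof.
apply: (big_ind (fun x => exists i, x = F i)); [by exists i0| |by move=> i; exists i].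
by move=> _ _ [i ->] [j ->]; case: (leP (F i) (F j)) => _; [exists i | exists j].
Qed.

(** That all four sides are attained allows a comparison with any other enclosing rectangle. *)
Lemma bounding_boxP (G : sgraph) (L : G -> rect) (v : G) :
  exists x0 y0 W H,
    [/\ area L = (W * H)%N, forall u, in_box x0 y0 W H (L u),
        (exists u, xlo (L u) = x0) /\ (exists u, xhi (L u) = x0 + W%:Z)
      & (exists u, ylo (L u) = y0) /\ (exists u, yhi (L u) = y0 + H%:Z)].
Proof.
rewrite /area; case: pickP => [v0 _ | /(_ v)//].
set X := \big[_/_]_u xhi _; set x := \big[_/_]_u xlo _.
set Y := \big[_/_]_u yhi _; set y := \big[_/_]_u ylo _.
have hX u : xhi (L u) <= X by apply: (le_bigmax _ (fun v => xhi (L v))).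
have hY u : yhi (L u) <= Y by apply: (le_bigmax _ (fun v => yhi (L v))).
have hx u : x <= xlo (L u) by apply: (bigmin_le _ _ (fun v => xlo (L v))).
have hy u : y <= ylo (L u) by apply: (bigmin_le _ _ (fun v => ylo (L v))).
have XE : X = x + `|X - x|%N%:Z.
  by have := hX v0; have := hx v0; have := xlo_lt_xhi (L v0); lia.
have YE : Y = y + `|Y - y|%N%:Z.
  by have := hY v0; have := hy v0; have := ylo_lt_yhi (L v0); lia.
exists x, y, `|X - x|%N, `|Y - y|%N; split=> //; rewrite -?XE -?YE.
- by move=> u; split; rewrite -?XE -?YE.
- split; first by have [u e] := bigmin_attained (fun v => xlo (L v)) v0; exists u.
  by have [u e] := bigmax_attained (fun v => xhi (L v)) v0; exists u.
- split; first by have [u e] := bigmin_attained (fun v => ylo (L v)) v0; exists u.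
  by have [u e] := bigmax_attained (fun v => yhi (L v)) v0; exists u.
Qed.

Lemma area_le_box (G : sgraph) (L : G -> rect) x0 y0 W H :
  (forall u, in_box x0 y0 W H (L u)) -> (area L <= W * H)%N.
Proof.
move=> inB; case: (pickP [pred v : G | true]) => [v _ | no]; last first.
  by rewrite /area; case: pickP => // v; have := no v.
have [x [y [W' [H' [-> _ [[a xa] [b xb]] [[c yc] [d yd]]]]]]] := bounding_boxP L v.
case: (inB a) (inB b) (inB c) (inB d) => a1 a2 a3 a4 [b1 b2 b3 b4] [c1 c2 c3 c4] [].
by move=> d1 d2 d3 d4; apply: leq_mul; lia.
Qed.

Lemma area_comp (G K : sgraph) (f : K -> G) (L : G -> rect) :
  (area (L \o f) <= area L)%N.
Proof.
case: (pickP [pred v : K | true]) => [v _ | no]; last first.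
  by rewrite {1}/area; case: pickP => // v; have := no v.
have [x [y [W [H [-> inB _ _]]]]] := bounding_boxP L (f v).
by apply: area_le_box => u; apply: inB.
Qed.

End BoundingBox.

Section Monotone.
Variable S : strategy.

(** An optimal rendering of [G], restricted along [f], stays in the same bounding box. *)
Lemma min_area_comp (G K : sgraph) (f : K -> G) : admits S G ->
    (forall L : G -> rect, S L -> @S K (L \o f)) ->
  min_area S K <= min_area S G.
Proof.
move=> /min_areaP[[L SL <-] _] Sf.
have SLf := Sf L SL.
by apply: leq_trans (area_comp f L); apply: (min_areaP (ex_intro _ _ SLf)).2.
Qed.

(** The scheme of every counterexample: [a] separates one rendering of [G] from all renderings of
    [K]. *)
Lemma min_area_lt (G K : sgraph) (L : G -> rect) a :
    S L -> area L <= a -> admits S K ->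
    (forall L' : K -> rect, S L' -> a < area L') ->
  min_area S G < min_area S K.
Proof.
move=> SL La /min_areaP[[L' SL' <-] _] aL'.
apply: leq_ltn_trans (aL' _ SL'); apply: leq_trans La.
exact: (min_areaP (ex_intro _ _ SL)).2.
Qed.

End Monotone.

(** * Restriction of weak and strong layouts to subgraphs *)

Section WeakStrong.
Variable R : realType.

Lemma weak_layout_comp (G K : sgraph) (f : K -> G) (L : G -> rect) :
    injective f -> (forall u v, adj u v -> adj (f u) (f v)) ->
  weak_layout R L -> @weak_layout R K (L \o f).
Proof.
move=> inj sub [disj touch]; split=> [u v uv | u v /sub/touch //].
by apply: disj; rewrite (inj_eq inj).
Qed.

(** Non-adjacency has to survive too, hence the equality: this covers induced subgraphs but not the
    deletion of edges. *)
Lemma strong_layout_comp (G K : sgraph) (f : K -> G) (L : G -> rect) :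
    injective f -> (forall u v, adj (f u) (f v) = adj u v) ->
  strong_layout R L -> @strong_layout R K (L \o f).
Proof.
move=> inj sub [weakL strongL]; split.
  by apply: weak_layout_comp weakL => // u v; rewrite sub.
by move=> u v uv /strongL; rewrite (inj_eq inj) sub; apply.
Qed.

Lemma weak_vertex_monotone : vertex_monotone (weak_layout R).
Proof.
move=> G V' admG _; apply: (@min_area_comp _ G (del_vertices V') val) => // L.
by apply: weak_layout_comp => //; apply: val_inj.
Qed.

Lemma weak_edge_monotone : edge_monotone (weak_layout R).
Proof.
move=> G E' _ admG _; apply: (@min_area_comp _ G (del_edges E') val) => // L.
by apply: weak_layout_comp => [|u v /andP[]//]; apply: val_inj.
Qed.

Lemma strong_vertex_monotone : vertex_monotone (strong_layout R).
Proof.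
move=> G V' admG _; apply: (@min_area_comp _ G (del_vertices V') val) => // L.
by apply: strong_layout_comp => //; apply: val_inj.
Qed.

End WeakStrong.

(** * Searching for layouts in a small box *)

Section Search.

Definition itv := (nat * nat)%type.
Definition box := (itv * itv)%type.
Definition box0 : box := ((0, 0), (0, 0)).

Definition itv_apart (i j : itv) := (i.2 <= j.1) || (j.2 <= i.1).
Definition itv_meet (i j : itv) := (i.2 == j.1) || (j.2 == i.1).

Definition apart (a b : box) := itv_apart a.1 b.1 || itv_apart a.2 b.2.

Definition contact (a b : box) :=
  itv_meet a.1 b.1 && ~~ itv_apart a.2 b.2 ||
  itv_meet a.2 b.2 && ~~ itv_apart a.1 b.1.

Definition compatible (c : bool) (a b : box) := apart a b && (contact a b == c).

Definition itvs n : seq itv := [seq (i, j) | i <- iota 0 n, j <- iota i.+1 (n - i)].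
Definition boxes W H : seq box := [seq (i, j) | i <- itvs W, j <- itvs H].

Lemma mem_itvs n i j : ((i, j) \in itvs n) = (i < j <= n).
Proof.
apply/allpairsPdep/idP => [[i' [j' [+ + [-> ->]]]] | ij].
  by rewrite !mem_iota; lia.
by exists i, j; split=> //; rewrite mem_iota; lia.
Qed.

Lemma mem_boxes W H b : (b \in boxes W H) =
  (b.1.1 < b.1.2 <= W) && (b.2.1 < b.2.2 <= H).
Proof.
case: b => [[x1 x2] [y1 y2]] /=; rewrite -!mem_itvs.
apply/allpairsP/andP => [[[i j] /= [iW jH [-> ->]]] // | [iW jH]].
by exists ((x1, x2), (y1, y2)).
Qed.

(** The unit cell is named by its lower left corner, hence the strict upper bounds. *)
Definition covers_cell (p : nat * nat) (b : box) :=
  [&& b.1.1 <= p.1, p.1 < b.1.2, b.2.1 <= p.2 & p.2 < b.2.2].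

Definition covers W H (s : seq box) :=
  all (fun i => all (fun j => has (covers_cell (i, j)) s) (iota 0 H)) (iota 0 W).

(* Forward checking: each remaining vertex carries the boxes still compatible
   with the boxes already placed. *)
Fixpoint refutes (final : pred (seq box)) (e : rel nat) n placed
    (cs : seq (nat * seq box)) :=
  if n is n'.+1 then
    if cs is (k, c) :: cs' then
      all (fun b =>
        let cs'' := [seq (let e' := e k d.1 in
                          (d.1, [seq x <- d.2 | compatible e' b x])) | d <- cs'] in
        if has (fun d => nilp d.2) cs'' then true
        else refutes final e n' (b :: placed) cs'') c
    else ~~ final placed
  else false.

(** Soundness against a fixed assignment [B]: along the branch that places every vertex as [B] does,
    filtering never discards a box of [B], so no list becomes empty and the branch ends in the test
    [final]. Exhausted fuel answers [false], hence never refutes. *)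
Lemma refutesP final e (B : nat -> box) n placed cs :
    refutes final e n placed cs -> uniq (unzip1 cs) ->
    {in unzip1 cs &, forall i j, i != j -> compatible (e i j) (B i) (B j)} ->
    (forall d, d \in cs -> B d.1 \in d.2) ->
  ~~ final (catrev (map B (unzip1 cs)) placed).
Proof.
elim: n placed cs => [|n IH] placed [|[k c] cs] //=.
move=> /allP ref /andP[kcs ucs] comp cand.
(* Follow the branch in which vertex [k] receives [B k]. *)
have /ref := cand _ (mem_head _ _) => /=.
set cs'' := map _ cs.
have cs''E : unzip1 cs'' = unzip1 cs by rewrite /unzip1 -map_comp; apply: eq_map.
have cand'' d : d \in cs'' -> B d.1 \in d.2.
  case/mapP => d' d'cs -> /=; rewrite mem_filter cand ?inE ?d'cs ?orbT // andbT.
  have dk : d'.1 \in unzip1 cs by apply: map_f.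
  apply: comp; rewrite ?inE ?eqxx ?dk ?orbT //.
  by apply: contraNneq kcs => ->.
case: ifP => [/hasP[d dcs /nilP dn] _ | _ /IH].
  by have := cand'' d dcs; rewrite dn.
rewrite cs''E; apply=> //.
by move=> i j ics jcs; apply: comp; rewrite inE ?ics ?jcs orbT.
Qed.

(* [cov] requires the boxes to fill the W x H box. *)
Definition refutes_area (cov : bool) n e a :=
  all (fun W => all (fun H =>
    refutes (fun s => cov ==> covers W H s) e n.+1 [::]
      [seq (k, boxes W H) | k <- iota 0 n])
    (iota 1 (a %/ W))) (iota 1 a).

(** The pairs with [W <= a] and [H <= a %/ W] are all box sizes of area at most [a]. The fuel [n.+1]
    allows [n] placements and the final test. *)
Lemma refutes_areaP cov n e a W H (B : nat -> box) :
    refutes_area cov n e a -> 0 < W -> 0 < H -> W * H <= a ->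
    (forall i, i < n -> B i \in boxes W H) ->
    (forall i j, i < n -> j < n -> i != j -> compatible (e i j) (B i) (B j)) ->
    (cov -> forall i j, i < W -> j < H ->
       exists2 k, k < n & covers_cell (i, j) (B k)) ->
  False.
Proof.
move=> /allP refA W0 H0 WHa inB comp cover.
have /refA/allP/(_ H) : W \in iota 1 a.
  by rewrite mem_iota add1n ltnS W0 (leq_trans _ WHa) // leq_pmulr.
rewrite mem_iota add1n ltnS H0 leq_divRL // mulnC => /(_ WHa).
have csE : unzip1 [seq (k, boxes W H) | k <- iota 0 n] = iota 0 n.
  by rewrite /unzip1 -map_comp map_id.
move=> /(refutesP (B := B)); rewrite csE iota_uniq => /(_ isT) ref.
apply: (negP (ref _ _)) => [i j|_ /mapP[k + ->]|]; rewrite ?mem_iota ?add0n /=.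
- exact: comp.
- exact: inB.
- case: (cov) cover => //= /(_ isT) cover.
  apply/allP=> i; rewrite mem_iota => iW; apply/allP=> j; rewrite mem_iota => jH.
  have [k kn ck] := cover i j iW jH.
  by apply/hasP; exists (B k) => //; rewrite catrevE cats0 mem_rev map_f // mem_iota.
Qed.

End Search.

(** * From rectangles to boxes and back *)

(** Coordinates relative to the corner [(x0, y0)]; the absolute values are exact for rectangles in a
    box with that lower left corner. *)
Definition box_of (x0 y0 : int) (r : rect) : box :=
  ((`|xlo r - x0|%N, `|xhi r - x0|%N), (`|ylo r - y0|%N, `|yhi r - y0|%N))%R.

Lemma box_of_mem x0 y0 W H r : in_box x0 y0 W H r -> box_of x0 y0 r \in boxes W H.
Proof.
move=> [*]; rewrite mem_boxes /=.
by have := xlo_lt_xhi r; have := ylo_lt_yhi r; lia.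
Qed.

Lemma apart_box_of x0 y0 W H r s :
    in_box x0 y0 W H r -> in_box x0 y0 W H s ->
  apart (box_of x0 y0 r) (box_of x0 y0 s) = xapart r s || yapart r s.
Proof.
move=> [? _ ? _] [? _ ? _]; rewrite /apart /itv_apart /xapart /yapart /=.
have := xlo_lt_xhi r; have := ylo_lt_yhi r.
by have := xlo_lt_xhi s; have := ylo_lt_yhi s; lia.
Qed.

Lemma contact_box_of x0 y0 W H r s :
    in_box x0 y0 W H r -> in_box x0 y0 W H s ->
  contact (box_of x0 y0 r) (box_of x0 y0 s) = rcontact r s.
Proof.
move=> [? _ ? _] [? _ ? _].
rewrite /contact /itv_apart /itv_meet /rcontact /xapart /yapart /xmeet /ymeet /=.
have := xlo_lt_xhi r; have := ylo_lt_yhi r.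
by have := xlo_lt_xhi s; have := ylo_lt_yhi s; lia.
Qed.

(* [maxn] only makes the rectangle nondegenerate; it is inert on the members
   of [boxes W H]. *)
Definition rect_of (b : box) : rect :=
  @Rect b.1.1 (maxn b.1.1.+1 b.1.2) b.2.1 (maxn b.2.1.+1 b.2.2)
    (leq_maxl _ _) (leq_maxl _ _).

Lemma rect_ofK W H b : b \in boxes W H -> box_of 0 0 (rect_of b) = b.
Proof.
case: b => [[x1 x2] [y1 y2]]; rewrite mem_boxes /= => b_wf.
by rewrite /box_of /=; congr ((_, _), (_, _)); lia.
Qed.

Lemma rect_of_in_box W H b : b \in boxes W H -> in_box 0 0 W H (rect_of b).
Proof.
by case: b => [[x1 x2] [y1 y2]]; rewrite mem_boxes /= => b_wf; split=> /=; lia.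
Qed.

Section Drawings.
Variable R : realType.

(** The conditions common to strong layouts and rectangular duals. *)
Definition drawing (G : sgraph) (L : G -> rect) :=
  interior_disjoint R L /\
  forall u v, u != v -> (share_segment R (L u) (L v) <-> adj u v).

Lemma strong_layoutP (G : sgraph) (L : G -> rect) :
  strong_layout R L <-> drawing L.
Proof.
split=> [[[disj touch] strong] | [disj touch]].
  by split=> // u v uv; split; [apply: strong | apply: touch].
split; last by move=> u v uv; have [+ _] := touch u v uv.
split=> // u v uv; apply/touch => //.
by apply: contraTneq uv => ->; rewrite adj_irrefl.
Qed.

(** Bridge from the real plane to a decidable test. Separation comes first, because contact
    characterises shared segments only for separated rectangles. *)
Lemma drawingP (G : sgraph) (L : G -> rect) x0 y0 W H :
    (forall u, in_box x0 y0 W H (L u)) ->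
  drawing L <-> forall u v, u != v ->
    compatible (adj u v) (box_of x0 y0 (L u)) (box_of x0 y0 (L v)).
Proof.
move=> inB; rewrite /compatible; split=> [[disj touch] u v uv | comp].
  rewrite (apart_box_of (inB u) (inB v)) (contact_box_of (inB u) (inB v)).
  have ap := (disjoint_insideP R _ _).1 (disj u v uv); rewrite ap /=.
  apply/eqP; apply/idP/idP => [rc|uv'].
    by apply/(touch u v uv)/share_segmentP.
  by apply/(share_segmentP R ap)/touch.
have ap u v : u != v -> xapart (L u) (L v) || yapart (L u) (L v).
  by move=> /comp/andP[+ _]; rewrite (apart_box_of (inB u) (inB v)).
split=> u v uv; first by apply/disjoint_insideP/ap.
have /comp/andP[_ /eqP <-] := uv; rewrite (contact_box_of (inB u) (inB v)).
exact: share_segmentP (ap u v uv).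
Qed.

(* Membership in a cell is tested at its centre. *)
Lemma region_cell (r : rect) x0 y0 W H i j : in_box x0 y0 W H r ->
    region r ((x0 + i%:Z)%:~R + 2^-1, (y0 + j%:Z)%:~R + 2^-1 : R)%R ->
  covers_cell (i, j) (box_of x0 y0 r).
Proof.
have half (z : int) (t : int) : (z%:~R <= t%:~R + 2^-1 :> R)%R -> (z <= t)%R.
  move=> zt; rewrite -ltzD1 -(ltr_int R) intrD; lra.
have half' (z : int) (t : int) : (t%:~R + 2^-1 <= z%:~R :> R)%R -> (t < z)%R.
  move=> zt; rewrite -(ltr_int R); lra.
move=> [? _ ? _] [/= /andP[/half a1 /half' a2] /andP[/half a3 /half' a4]].
by rewrite /covers_cell /=; lia.
Qed.

End Drawings.

(** * Area bounds and explicit renderings for numbered graphs *)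

Section Coding.

(** Numbering the vertices lets one search over [nat] serve the subtypes left by deletions as
    well. *)
Record coding (G : sgraph) n (e : rel nat) (idx : G -> nat) : Prop := Coding {
  coding_inj : injective idx;
  coding_lt : forall v, idx v < n;
  coding_onto : forall i, i < n -> exists v, idx v = i;
  coding_adj : forall u v, adj u v = e (idx u) (idx v)
}.

Variables (R : realType) (G : sgraph) (n : nat) (e : rel nat) (idx : G -> nat).
Hypothesis codingG : coding n e idx.

(** A drawing of area at most [a], translated so that its bounding box starts at the origin, would
    be an assignment that the search has excluded. *)
Lemma drawing_area_gt cov a (L : G -> rect) : 0 < n ->
    refutes_area cov n e a -> drawing R L ->
    (cov -> exists B : rect,
       (\bigcup_(v in [set: G]) @region R (L v) = region B)%classic) ->
  a < area L.
Proof.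
case: codingG => inj lt onto adjE n0 ref drawL fill.
have [v0 _] := onto 0 n0.
have [x0 [y0 [W [H [-> inB [[v1 e1] [v2 e2]] [[v3 e3] [v4 e4]]]]]]] :=
  bounding_boxP L v0.
rewrite ltnNge; apply/negP => WHa.
(* [f] inverts [idx]; [v0] is only the default outside the range. *)
pose f i := odflt v0 [pick v | idx v == i].
have fK i : i < n -> idx (f i) = i.
  move=> /onto[v vi]; rewrite /f; case: pickP => [u /eqP // | /(_ v)].
  by rewrite vi eqxx.
have W0 : 0 < W by have := xlo_lt_xhi (L v0); case: (inB v0); lia.
have H0 : 0 < H by have := ylo_lt_yhi (L v0); case: (inB v0); lia.
apply: (refutes_areaP (B := fun i => box_of x0 y0 (L (f i))) ref W0 H0 WHa).
- by move=> i _; apply: box_of_mem.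
- move=> i j /fK fi /fK fj ij; rewrite -{1}fi -{1}fj -adjE.
  by apply: (drawingP R inB).1 => //; apply: contraNneq ij => eq; rewrite -fi -fj eq.
move=> /fill[B BE] i j iW jH.
(* The corners of each [L v] lie in [B], so [B] contains the bounding box, whose sides are attained
   at [v1] to [v4]. The centre of each cell is thus in [B], hence in some rectangle. *)
have subB v p : region (L v) p -> @region R B p by move=> pv; rewrite -BE; exists v.
have lo v : (xlo B <= xlo (L v))%R /\ (ylo B <= ylo (L v))%R.
  have [] := subB v ((xlo (L v))%:~R, (ylo (L v))%:~R)%R.
    by have := xlo_lt_xhi (L v); have := ylo_lt_yhi (L v); split; rewrite /= !ler_int; lia.
  by rewrite /= !ler_int => /andP[-> _] /andP[-> _].
have hi v : (xhi (L v) <= xhi B)%R /\ (yhi (L v) <= yhi B)%R.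
  have [] := subB v ((xhi (L v))%:~R, (yhi (L v))%:~R)%R.
    by have := xlo_lt_xhi (L v); have := ylo_lt_yhi (L v); split; rewrite /= !ler_int; lia.
  by rewrite /= !ler_int => /andP[_ ->] /andP[_ ->].
have [v _ vp] : (\bigcup_(v in [set: G]) @region R (L v))%classic
    ((x0 + i%:Z)%:~R + 2^-1, (y0 + j%:Z)%:~R + 2^-1)%R.
  have cell (l h t : int) : (l <= t -> t + 1 <= h ->
      l%:~R <= t%:~R + (2^-1 : R) <= h%:~R)%R.
    by rewrite -!(ler_int R) intrD => *; lra.
  have [[? _] [? _]] := (lo v1, hi v2); have [[_ ?] [_ ?]] := (lo v3, hi v4).
  by rewrite BE; split; apply: cell; lia.
exists (idx v); first exact: lt.
rewrite (inj _ _ (fK _ (lt v))).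
exact: region_cell vp.
Qed.

Variables (W H : nat) (bs : seq box).

Definition layoutb :=
  [&& size bs == n, all (fun b => b \in boxes W H) bs
    & all (fun i => all (fun j => (i == j) ||
        compatible (e i j) (nth box0 bs i) (nth box0 bs j))
        (iota 0 n)) (iota 0 n)].

Definition at_point (p : nat * nat) (b : box) :=
  (b.1.1 <= p.1 <= b.1.2) && (b.2.1 <= p.2 <= b.2.2).

Definition dualb :=
  covers W H bs &&
  all (fun i => all (fun j => count (at_point (i, j)) bs < 4) (iota 0 H.+1)) (iota 0 W.+1).

Definition layout (v : G) : rect := rect_of (nth box0 bs (idx v)).

Hypothesis layoutbT : layoutb.

Lemma layout_box v : nth box0 bs (idx v) \in boxes W H.
Proof.
case/and3P: layoutbT => /eqP sz /allP inB _.
by apply/inB/mem_nth; rewrite sz; apply: (coding_lt codingG).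
Qed.

Lemma layout_in_box v : in_box 0 0 W H (layout v).
Proof. by apply: rect_of_in_box; apply: layout_box. Qed.

Lemma layout_area : area layout <= W * H.
Proof. by apply: area_le_box => v; apply: layout_in_box. Qed.

Lemma layout_drawing : drawing R layout.
Proof.
apply/(drawingP R layout_in_box) => u v uv.
rewrite !(rect_ofK (layout_box _)) (coding_adj codingG).
case/and3P: layoutbT => _ _ /allP/(_ (idx u)).
rewrite mem_iota (coding_lt codingG) => /(_ isT)/allP/(_ (idx v)).
rewrite mem_iota (coding_lt codingG) => /(_ isT).
by rewrite (inj_eq (coding_inj codingG)) (negPf uv).
Qed.

(** The cells are closed on both sides, so the last one takes [t = N]. *)
Lemma itv_cell (N : nat) (t : R) : (0 < N)%N -> (0 <= t <= N%:R ->
  exists2 i : nat, (i < N)%N & i%:R <= t <= i.+1%:R)%R.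
Proof.
case: N => // N _; elim: N => [|N IH] /andP[t0 tN].
  by exists 0 => //; rewrite t0.
case: (leP t N.+1%:R%R) => [tN'|/ltW Nt].
  have [|i iN it] := IH; first by rewrite t0.
  by exists i => //; apply: ltnW.
by exists N.+1 => //; rewrite Nt.
Qed.

Lemma layout_dual : 0 < W -> 0 < H -> dualb -> rectangular_dual R layout.
Proof.
move=> W0 H0 /andP[cov four].
case/and3P: layoutbT => /eqP sz /allP inB _.
have [disj touch] := layout_drawing.
split=> //.
- exists (@Rect 0 W 0 H W0 H0); apply/seteqP; split=> [[x y] [v _ []] | [x y] []] /=.
    have [] := layout_in_box v; rewrite -!(ler_int R) !add0r => *.
    by split=> /=; lra.
  move=> /(itv_cell W0)[i iW /andP[ix xi]] /(itv_cell H0)[j jH /andP[jy yj]].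
  move/allP: cov => /(_ i); rewrite mem_iota iW => /(_ isT)/allP/(_ j).
  rewrite mem_iota jH => /(_ isT)/(has_nthP box0)[k].
  rewrite sz => /(coding_onto codingG)[v <-] /and4P[/= c1 c2 c3 c4].
  exists v => //; have := layout_box v; rewrite mem_boxes /layout.
  move: (nth _ _ _) c1 c2 c3 c4 => [[x1 x2] [y1 y2]] /= c1 c2 c3 c4 wf.
  rewrite /region /= -!pmulrn.
  have -> : maxn x1.+1 x2 = x2 by lia.
  have -> : maxn y1.+1 y2 = y2 by lia.
  have le_nat (a b : nat) : a <= b -> (a%:R <= b%:R :> R)%R by rewrite ler_nat.
  move: (le_nat _ _ c1) (le_nat _ _ c2) (le_nat _ _ c3) (le_nat _ _ c4) => *.
  by split; lra.
(* Rounding a common point down to the grid keeps it in each rectangle: integer lower bounds survive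
   the rounding, and upper bounds only get easier. Testing grid points therefore suffices. *)
- move=> A A4 [[x y] Ap].
  have [u uA] : exists u, u \in A by apply/card_gt0P; rewrite A4.
  have xy0 v : v \in A -> (0 <= x /\ 0 <= y)%R.
    move=> /Ap[/= /andP[+ _] /andP[+ _]]; rewrite -!pmulrn => a b.
    by split; [exact: le_trans (ler0n _ _) a | exact: le_trans (ler0n _ _) b].
  have [x0 y0] := xy0 u uA.
  have /andP[ix xi] := truncn_itv x0; have /andP[jy yj] := truncn_itv y0.
  set i := Num.truncn x in ix xi; set j := Num.truncn y in jy yj.
  have le_lt (a b : nat) (t : R) : (a%:R <= t -> t < b.+1%:R -> (a <= b)%N)%R.
    by move=> at' tb; rewrite -ltnS -(ltr_nat R); apply: le_lt_trans tb.
  have le_le (a b : nat) (t : R) : (a%:R <= t -> t <= b%:R -> (a <= b)%N)%R.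
    by move=> at' tb; rewrite -(ler_nat R); apply: le_trans tb.
  have atA v : v \in A -> at_point (i, j) (nth box0 bs (idx v)).
    move=> /Ap; have := layout_box v; rewrite mem_boxes /layout.
    move: (nth _ _ _) => [[x1 x2] [y1 y2]] /= wf; rewrite /region /= -!pmulrn.
    have -> : maxn x1.+1 x2 = x2 by lia.
    have -> : maxn y1.+1 y2 = y2 by lia.
    case=> /andP[a1 a2] /andP[a3 a4]; rewrite /at_point /=.
    by rewrite (le_lt _ _ _ a1 xi) (le_lt _ _ _ a3 yj) (le_le _ _ _ ix a2) (le_le _ _ _ jy a4).
  have [iW jH] : i < W.+1 /\ j < H.+1.
    case/andP: (atA u uA) => /andP[_ a] /andP[_ b].
    have := layout_box u; rewrite mem_boxes => /andP[/andP[_ c] /andP[_ d]].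
    by rewrite !ltnS; split; [apply: leq_trans a c | apply: leq_trans b d].
  move/allP: four => /(_ i); rewrite mem_iota iW => /(_ isT)/allP/(_ j).
  rewrite mem_iota jH => /(_ isT); rewrite ltnNge => /negP; apply.
  (* The vertices of [A] give four distinct positions in [bs] whose boxes contain [(i, j)], against
     the count. *)
  rewrite -A4 cardE -(size_map idx) -(mkseq_nth box0 bs) sz.
  rewrite count_map -size_filter; apply: uniq_leq_size.
    by rewrite map_inj_uniq ?enum_uniq //; apply: coding_inj codingG.
  move=> _ /mapP[v + ->]; rewrite mem_enum => vA.
  by rewrite mem_filter mem_iota (coding_lt codingG); apply/andP; split=> //; apply: atA.
Qed.

End Coding.

(** * The counterexamples *)

Definition erel (es : seq (nat * nat)) : rel nat :=
  fun i j => (i != j) && (((i, j) \in es) || ((j, i) \in es)).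

Lemma erel_sym es : symmetric (erel es).
Proof. by move=> i j; rewrite /erel eq_sym orbC. Qed.

Section GraphOn.
Variables (n : nat) (es : seq (nat * nat)).

Definition graph_on : sgraph :=
  @SGraph 'I_n (fun i j => erel es i j) (fun i j => erel_sym es i j)
    (fun i => introF idP (fun h => negP (andP h).1 (eqxx _))).
End GraphOn.

Lemma coding_graph_on n es :
  @coding (graph_on n es) n (erel es) (@nat_of_ord n).
Proof.
by split=> //; [apply: val_inj | move=> i ilt; exists (Ordinal ilt)].
Qed.

(** Deleting the last vertex keeps the other numbers, so the same list [es] still describes
    adjacency. *)
Lemma coding_del_vertex n es
    (idx := fun v : del_vertices [set ord_max : graph_on n.+1 es] => val (val v)) :
  coding n (erel es) idx.
Proof.
split=> //.
- by move=> u v /val_inj/val_inj.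
- case=> v /=; rewrite /idx /= inE => vn; have := ltn_ord v; rewrite ltnS leq_eqVlt.
  by case/orP=> // /eqP e; case/negP: vn; apply/eqP/val_inj.
- move=> i ilt; have ilt' := ltnW ilt.
  have iV : (Ordinal (ilt' : i < n.+1) : graph_on n.+1 es) \notin [set ord_max]%SET.
    by rewrite inE -val_eqE /= neq_ltn ilt.
  by exists (exist (fun v => v \notin [set ord_max]%SET) _ iV).
Qed.

(** The deleted edges are given through the list [es'] of those that stay. *)
Definition removed n (es es' : seq (nat * nat)) : {set {set graph_on n es}} :=
  [set [set p.1; p.2] | p : graph_on n es * graph_on n es
     & adj p.1 p.2 && ~~ erel es' (val p.1) (val p.2)]%SET.

Lemma removed_edges n es es' : removed n es es' \subset edges (graph_on n es).
Proof.
apply/fintype.subsetP => _ /imsetP[p + ->]; rewrite inE => /andP[pq _].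
by apply/imsetP; exists p; rewrite ?inE.
Qed.

Lemma kept_removed n es es' (u v : graph_on n es) :
  {subset es' <= es} -> kept (removed n es es') u v = erel es' u v.
Proof.
move=> sub; have erelS i j : erel es' i j -> erel es i j.
  by case/andP=> ij /orP[] /sub h; rewrite /erel ij h ?orbT.
apply/andP/idP => [[uv]|uv].
  by apply: contraR => nuv; apply/imsetP; exists (u, v) => //; rewrite inE; apply/andP.
split; first exact: erelS.
apply/imsetP => -[[a b]]; rewrite inE /= => /andP[_ nab] eq.
have ua : u \in [set a; b]%SET by rewrite -eq set21.
have va : v \in [set a; b]%SET by rewrite -eq set22.
have uv' : u != v by case/andP: uv.
(* As [u != v], the pair [(u, v)] is [(a, b)] or [(b, a)]; symmetry of [erel] settles the second
   case. *)
case/set2P: ua va uv uv' nab => -> /set2P[] ->; rewrite ?eqxx // => h _.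
  by rewrite h.
by rewrite erel_sym h.
Qed.

(** The check over [iota 0 n] says that no vertex becomes isolated, so none is dropped and the
    numbering stays onto. *)
Lemma coding_del_edges n es es'
    (idx := fun v : del_edges (removed n es es') => val (val v)) :
  {subset es' <= es} -> all (fun i => has (erel es' i) (iota 0 n)) (iota 0 n) ->
  coding n (erel es') idx.
Proof.
move=> sub /allP iso; split=> //.
- by move=> u v /val_inj/val_inj.
- by move=> v; apply: ltn_ord.
- move=> i ilt; have /iso/hasP[j] : i \in iota 0 n by rewrite mem_iota.
  rewrite mem_iota /= => jlt ij.
  have iV : [exists u, kept (removed n es es') (Ordinal ilt : graph_on n es) u].
    by apply/existsP; exists (Ordinal jlt); rewrite kept_removed.
  by exists (exist (fun v => [exists u, kept (removed n es es') v u]) _ iV).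
- by move=> u v; rewrite -kept_removed.
Qed.

Section Realize.
Variables (R : realType) (G : sgraph) (n : nat) (e : rel nat) (idx : G -> nat).
Hypothesis codingG : coding n e idx.

Lemma strong_layout_gt a (L : G -> rect) : 0 < n ->
  refutes_area false n e a -> strong_layout R L -> a < area L.
Proof.
by move=> n0 ref /strong_layoutP drawL; apply: (drawing_area_gt codingG n0 ref drawL).
Qed.

Lemma rectangular_dual_gt a (L : G -> rect) : 0 < n ->
  refutes_area true n e a -> rectangular_dual R L -> a < area L.
Proof.
move=> n0 ref [disj fill _ touch].
exact: (drawing_area_gt codingG n0 ref (conj disj touch) (fun _ => fill)).
Qed.

Lemma layout_strong W H bs : layoutb n e W H bs -> strong_layout R (layout idx bs).
Proof. by move=> bsP; apply/strong_layoutP; apply: layout_drawing bsP. Qed.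

End Realize.

(** * The three failures of monotonicity *)

Lemma strong_not_edge_monotone (R : realType) : ~ edge_monotone (strong_layout R).
Proof.
pose es := [:: (0, 1); (1, 2); (2, 3)]; pose es' := [:: (0, 1); (2, 3)].
(* Unit squares in a row; [bs'] leaves a gap between the two edges. *)
pose bs : seq box := [:: (0, 1, (0, 1)); (1, 2, (0, 1)); (2, 3, (0, 1)); (3, 4, (0, 1))].
pose bs' : seq box := [:: (0, 1, (0, 1)); (1, 2, (0, 1)); (3, 4, (0, 1)); (4, 5, (0, 1))].
have codG := coding_graph_on 4 es.
have codK : coding 4 (erel es') (fun v : del_edges (removed 4 es es') => val (val v)).
  by apply: coding_del_edges => //; apply/allP.
have bsP : layoutb 4 (erel es) 4 1 bs by [].
have bsP' : layoutb 4 (erel es') 5 1 bs' by [].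
have SG := layout_strong R codG bsP; have SK := layout_strong R codK bsP'.
have areaG := layout_area codG bsP.
have ref : refutes_area false 4 (erel es') 4 by vm_compute.
have lt := min_area_lt SG areaG (ex_intro _ _ SK)
  (fun L' => strong_layout_gt codK isT ref (L := L')).
move=> /(_ _ _ (removed_edges 4 es es') (ex_intro _ _ SG) (ex_intro _ _ SK)).
by rewrite leqNgt lt.
Qed.

Lemma dual_not_edge_monotone (R : realType) : ~ edge_monotone (rectangular_dual R).
Proof.
(* The triangles on [0, 1, 2] and [0, 3, 4] share [0]; without [(0, 4)] the second becomes the tail
   [0, 3, 4]. *)
pose es' := [:: (0, 1); (0, 2); (1, 2); (0, 3); (3, 4)]; pose es := (0, 4) :: es'.
pose bs : seq box := [:: (0, 2, (1, 2)); (0, 1, (0, 1)); (1, 2, (0, 1));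
                         (0, 1, (2, 3)); (1, 2, (2, 3))].
pose bs' : seq box := [:: (0, 2, (1, 2)); (0, 1, (0, 1)); (1, 2, (0, 1));
                          (0, 2, (2, 3)); (0, 2, (3, 4))].
have codG := coding_graph_on 5 es.
have codK : coding 5 (erel es') (fun v : del_edges (removed 5 es es') => val (val v)).
  by apply: coding_del_edges => //; apply/allP.
have bsP : layoutb 5 (erel es) 2 3 bs by [].
have bsP' : layoutb 5 (erel es') 2 4 bs' by [].
have SG := layout_dual R codG bsP isT isT isT.
have SK := layout_dual R codK bsP' isT isT isT.
have areaG := layout_area codG bsP.
have ref : refutes_area true 5 (erel es') 6 by vm_compute.
have lt := min_area_lt SG areaG (ex_intro _ _ SK)
  (fun L' => rectangular_dual_gt codK isT ref (L := L')).
move=> /(_ _ _ (removed_edges 5 es es') (ex_intro _ _ SG) (ex_intro _ _ SK)).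
by rewrite leqNgt lt.
Qed.

Lemma dual_not_vertex_monotone (R : realType) : ~ vertex_monotone (rectangular_dual R).
Proof.
pose es := [:: (0, 1); (0, 2); (0, 3); (1, 2); (2, 3); (0, 4); (4, 5); (5, 6);
               (0, 7); (4, 7); (5, 7); (6, 7)].
(* Vertex [7], the one deleted, shares a row with [4] and lets [5] and [6] share the next; without
   it the tail [4, 5, 6] takes three full rows in [bs']. *)
pose bs : seq box := [:: (0, 3, (1, 2)); (0, 1, (0, 1)); (1, 2, (0, 1)); (2, 3, (0, 1));
  (0, 1, (2, 3)); (0, 2, (3, 4)); (2, 3, (3, 4)); (1, 3, (2, 3))].
pose bs' : seq box := [:: (0, 3, (1, 2)); (0, 1, (0, 1)); (1, 2, (0, 1)); (2, 3, (0, 1));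
  (0, 3, (2, 3)); (0, 3, (3, 4)); (0, 3, (4, 5))].
have codG := coding_graph_on 8 es; have codK := coding_del_vertex 7 es.
have bsP : layoutb 8 (erel es) 3 4 bs by [].
have bsP' : layoutb 7 (erel es) 3 5 bs' by [].
have SG := layout_dual R codG bsP isT isT isT.
have SK := layout_dual R codK bsP' isT isT isT.
have areaG := layout_area codG bsP.
(* The covering test is essential: [bs] without its last box draws the smaller graph in area 12, but
   with a hole. *)
have ref : refutes_area true 7 (erel es) 12 by vm_compute.
have lt := min_area_lt SG areaG (ex_intro _ _ SK)
  (fun L' => rectangular_dual_gt codK isT ref (L := L')).
move=> /(_ _ _ (ex_intro _ _ SG) (ex_intro _ _ SK)).
by rewrite leqNgt lt.
Qed.

Theorem theorem11 (R : realType) :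
  [/\ vertex_monotone (weak_layout R) /\ edge_monotone (weak_layout R),
      vertex_monotone (strong_layout R) /\ ~ edge_monotone (strong_layout R)
    & ~ vertex_monotone (rectangular_dual R) /\
      ~ edge_monotone (rectangular_dual R)].
Proof.
split; split.
- exact: weak_vertex_monotone.
- exact: weak_edge_monotone.
- exact: strong_vertex_monotone.
- exact: strong_not_edge_monotone.
- exact: dual_not_vertex_monotone.
- exact: dual_not_edge_monotone.
Qed.
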